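(* Let $X$ be an NPC space, let $G$ be a locally compact group acting continuously by isometries on $X$, and let $\xi \in \partial X$. Let $g \in G$ have unbounded action on $X$ with attracting point $\xi$. Then $\mathrm{par}_G(g^{-1}) \le G_{\xi}$. If moreover $g$ is hyperbolic and the action of $G$ is proper, then $\mathrm{par}_G(g^{-1}) = G_{\xi}$.
   Context: An NPC space is a geodesic metric space $X$ that is either (a) complete and CAT(0), or (b) proper (closed balls are compact) and $\delta$-hyperbolic for some $\delta \ge 0$ (every geodesic triangle is $\delta$-thin: each point on a side lies within distance $\delta$ of a point on another side). The boundary $\partial X$ is the set of equivalence classes of geodesic rays $\gamma:\mathbb{R}_{\ge 0}\to X$, where $\gamma_1\sim\gamma_2$ if $d(\gamma_1(t),\gamma_2(t))$ is bounded over $t\ge 0$; isometries of $X$ act on $\partial X$, and $G_\xi$ denotes the stabilizer of $\xi$ in $G$. Convergence of sequences of points of $X$ to boundary points is in the usual sense (cone topology for CAT(0) spaces, Gromov boundary for proper $\delta$-hyperbolic spaces). An isometry $g$ has bounded action if the orbits of $\langle g\rangle$ on $X$ are bounded, and unbounded action otherwise. An isometry $g$ is hyperbolic if: in case (a), it has an axis, i.e. there are a geodesic line $\gamma:\mathbb{R}\to X$ and $k>0$ with $g\gamma(t)=\gamma(t+k)$ for all $t$; in case (b), $n\mapsto g^nx$ is a quasi-isometric embedding of $\mathbb{Z}$ into $X$ for some (equivalently any) $x\in X$. A point $\xi\in\partial X$ is the attracting point $\xi_+(g)$ of $g$ if $g^nx\to\xi$ as $n\to+\infty$ for all $x\in X$.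 An action of a locally compact group $G$ by isometries on $X$ is proper if for all $x\in X$ and $r>0$ the set $\{g\in G: d(gx,x)\le r\}$ has compact closure. The parabolic group of $g \in G$ is $\mathrm{par}_G(g)=\{x\in G : \{g^nxg^{-n}: n\ge 0\}\text{ has compact closure in }G\}$. *)

(* Defs.v *)
From HB Require Import structures.
From mathcomp Require Import all_boot all_order all_algebra.
From mathcomp Require Import all_classical all_reals all_analysis.

Set Implicit Arguments.
Unset Strict Implicit.
Unset Printing Implicit Defensive.

Import Order.TTheory GRing.Theory Num.Theory.
Import numFieldNormedType.Exports.

Local Open Scope classical_set_scope.
Local Open Scope ring_scope.

HB.mixin Record isTopologicalGroup G of Group G & Topological G := {
  mulg_continuous : continuous (fun p : G * G => (p.1 * p.2)%g) ;
  invg_continuous : continuous (fun x : G => x^-1%g)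
}.

(* Hausdorffness is not required. *)
#[short(type="topologicalGroupType")]
HB.structure Definition TopologicalGroup :=
  { G of Group G & Topological G & isTopologicalGroup G }.

Definition zpow (G : groupType) (g : G) (n : int) : G :=
  match n with
  | Posz m => (g ^+ m)%g
  | Negz m => (g ^- m.+1)%g
  end.

Section Geodesics.
Context {R : realType} {X : metricType R}.
Implicit Types (p q r x y : X) (s gamma : R -> X).

(* Only the values of [s] on the interval [0, d(p, q)] matter. *)
Definition geodesic_path p q s :=
  [/\ s 0 = p, s (mdist p q) = q &
      forall t u, 0 <= t <= mdist p q -> 0 <= u <= mdist p q ->
        mdist (s t) (s u) = `|t - u|].

Definition geodesic_segment p q (S : set X) :=
  exists2 s, geodesic_path p q s & S = s @` [set t | 0 <= t <= mdist p q].

(* Rays are represented by functions on R whose values at negative arguments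
   are arbitrary. *)
Definition geodesic_ray gamma :=
  forall t u, 0 <= t -> 0 <= u -> mdist (gamma t) (gamma u) = `|t - u|.

Definition geodesic_line gamma :=
  forall t u, mdist (gamma t) (gamma u) = `|t - u|.

Definition asymptotic gamma1 gamma2 :=
  exists M : R, forall t, 0 <= t -> mdist (gamma1 t) (gamma2 t) <= M.

(* A boundary point is an equivalence class of rays.  It contains, with a ray,
   every function that agrees with it on nonnegative arguments, so the
   arbitrary values do not create additional boundary points. *)
Definition boundary : set (set (R -> X)) :=
  [set xi | exists2 gamma, geodesic_ray gamma &
    xi = [set gamma' | geodesic_ray gamma' /\ asymptotic gamma gamma']].

Definition metric_bounded (A : set X) :=
  exists M : R, forall x y, A x -> A y -> mdist x y <= M.

Definition gromov_product (o x y : X) : R :=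
  (mdist x o + mdist y o - mdist x y) / 2.

(* The sets of points x with d(c(0), x) > r and d(p_r(x), c(r)) < e, where c is
   a ray in the class xi and p_r(x) is the point at distance r from c(0) on the
   geodesic from c(0) to x, are the traces on X of the basic neighbourhoods of
   xi in the cone topology. *)
Definition cone_cvg (u : nat -> X) (xi : set (R -> X)) :=
  forall c, xi c -> forall r e : R, 0 < r -> 0 < e ->
    \forall n \near \oo, r < mdist (c 0) (u n) /\
      forall s, geodesic_path (c 0) (u n) s -> mdist (s r) (c r) < e.

(* (u n | c t)_o tends to infinity as n and t tend to infinity. *)
Definition gromov_cvg (u : nat -> X) (xi : set (R -> X)) :=
  forall c, xi c -> forall (o : X) (M : R),
    \forall n \near \oo & t \near +oo, M <= gromov_product o (u n) (c t).

End Geodesics.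

Section EuclideanPlane.
Context {R : realType}.
Implicit Types p q x : (R * R)%type.

Definition edist p q : R :=
  Num.sqrt ((p.1 - q.1) ^+ 2 + (p.2 - q.2) ^+ 2).

Definition on_esegment p q x :=
  exists2 a : R, 0 <= a <= 1 &
    x = ((1 - a) * p.1 + a * q.1, (1 - a) * p.2 + a * q.2).

End EuclideanPlane.

Section Spaces.
Context {R : realType} (X : metricType R).

Definition geodesic_space := forall p q : X, exists s, geodesic_path p q s.

Definition metric_complete :=
  forall F : set_system X, ProperFilter F -> cauchy F -> exists x : X, F --> x.

Definition proper_space :=
  forall (x : X) (r : R), compact [set y | mdist x y <= r].

(* Any two sides of a geodesic triangle share a vertex, here called p; two
   points on the same side are at the distance of their comparison points. *)
Definition cat0_inequality :=
  forall (p q r : X) (S1 S2 : set X),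
    geodesic_segment p q S1 -> geodesic_segment p r S2 ->
  forall p' q' r' : R * R,
    edist p' q' = mdist p q -> edist p' r' = mdist p r ->
    edist q' r' = mdist q r ->
  forall (x y : X) (x' y' : R * R),
    S1 x -> on_esegment p' q' x' -> edist p' x' = mdist p x ->
    S2 y -> on_esegment p' r' y' -> edist p' y' = mdist p y ->
    mdist x y <= edist x' y'.

Definition cat0 := geodesic_space /\ cat0_inequality.

(* The vertices are arbitrary, so it is enough to consider points on [p, q]. *)
Definition thin_triangles (delta : R) :=
  forall (p q r : X) (S1 S2 S3 : set X),
    geodesic_segment p q S1 -> geodesic_segment q r S2 ->
    geodesic_segment r p S3 ->
  forall x, S1 x -> exists2 y, (S2 `|` S3) y & mdist x y <= delta.

Definition gromov_hyperbolic :=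
  geodesic_space /\ exists2 delta : R, 0 <= delta & thin_triangles delta.

End Spaces.

(* The notions of convergence to the boundary and of hyperbolic isometry depend
   on which clause of the definition of an NPC space is used, so the clause is
   recorded explicitly. *)
Inductive npc_kind := CompleteCat0 | ProperHyperbolic.

Definition npc (k : npc_kind) {R : realType} (X : metricType R) :=
  match k with
  | CompleteCat0 => metric_complete X /\ cat0 X
  | ProperHyperbolic => proper_space X /\ gromov_hyperbolic X
  end.

Definition boundary_cvg (k : npc_kind) {R : realType} {X : metricType R}
    (u : nat -> X) (xi : set (R -> X)) :=
  match k with
  | CompleteCat0 => cone_cvg u xi
  | ProperHyperbolic => gromov_cvg u xi
  end.

Section Actions.
Context {R : realType} {X : metricType R} {G : topologicalGroupType}.
Variable act : G -> X -> X.

Record continuous_isometric_action : Prop := {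
  act1 : forall x, act 1%g x = x ;
  actM : forall g h x, act (g * h)%g x = act g (act h x) ;
  act_isometry : forall g x y, mdist (act g x) (act g y) = mdist x y ;
  act_continuous : continuous (fun p : G * X => act p.1 p.2)
}.

Definition proper_action :=
  forall (x : X) (r : R), 0 < r ->
    compact (closure [set g | mdist (act g x) x <= r]).

Definition boundary_act (g : G) (xi : set (R -> X)) : set (R -> X) :=
  [set act g \o gamma | gamma in xi].

Definition boundary_stabilizer (xi : set (R -> X)) : set G :=
  [set g | boundary_act g xi = xi].

Definition bounded_isometry (g : G) :=
  forall x, metric_bounded (range (fun n : int => act (zpow g n) x)).

Definition has_axis (g : G) :=
  exists (gamma : R -> X) (k : R),
    [/\ geodesic_line gamma, 0 < k & forall t, act g (gamma t) = gamma (t + k)].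

Definition qi_embedded_orbit (g : G) (x : X) :=
  exists L C : R, [/\ 1 <= L, 0 <= C &
    forall m n : int,
      L^-1 * `|m - n|%:~R - C <= mdist (act (zpow g m) x) (act (zpow g n) x)
      <= L * `|m - n|%:~R + C].

Definition hyperbolic_isometry (k : npc_kind) (g : G) :=
  match k with
  | CompleteCat0 => has_axis g
  | ProperHyperbolic => exists x, qi_embedded_orbit g x
  end.

Definition attracting_point (k : npc_kind) (g : G) (xi : set (R -> X)) :=
  forall x, boundary_cvg k (fun n => act (g ^+ n)%g x) xi.

End Actions.

Definition parabolic_group {G : topologicalGroupType} (g : G) : set G :=
  [set x | compact (closure (range (fun n : nat => g ^+ n * x * g ^- n)%g))].

(* Main.v *)
Require Import Defs.
From mathcomp Require Import all_boot all_order all_algebra.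
From mathcomp Require Import all_classical all_reals all_analysis.
From mathcomp Require Import ring lra.

Set Implicit Arguments.
Unset Strict Implicit.
Unset Printing Implicit Defensive.

Import Order.TTheory GRing.Theory Num.Theory.
Import numFieldNormedType.Exports.

Local Open Scope classical_set_scope.
Local Open Scope ring_scope.

(** The two kinds of spaces are treated together through two properties.

    - Stability of quadrilaterals: two geodesics whose endpoints are at distance
      at most D from one another stay at distance at most E(D), at equal times.
      In the CAT(0) case this follows from the comparison of two triangles that
      share a diagonal of the quadrilateral ([cat0_stable_quadrilaterals]), in
      the hyperbolic case from the thinness of these two triangles
      ([hyperbolic_stable_quadrilaterals]).
    - If u n converges to the endpoint of a ray c, then the geodesics from c 0
      to u n pass within a uniform distance K of c r, for n large with respect
      to r.  In the CAT(0) case this is the definition of the cone topology; in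
      the hyperbolic case two geodesics from p to y and z stay 2 delta-close up
      to a time slightly smaller than the Gromov product of y and z
      ([gromov_fellow]).

    If h lies in the parabolic group of g^-1, then continuity of the action and
    compactness bound the displacement d(g^n o, h g^n o) uniformly in n.  Take
    o = c 0, where c is a ray towards xi: the geodesics from c 0 to g^n o
    approach c, their images under h approach h c, and by stability of
    quadrilaterals both families stay close to one another.  So h c is
    asymptotic to c, that is, h fixes xi.

    Conversely, let h fix xi, and let the action be proper.  It is enough to
    bound d(g^n o, h g^n o) for one point o, and this follows if the points
    g^n o stay close to a ray towards xi, because h moves such a ray a bounded
    distance.  In the CAT(0) case the points g^n o lie on an axis, whose
    positive half is asymptotic to c.  In the hyperbolic case put
    a(n) = d(o, g^n o).  As a grows at least linearly, a(2N) - a(N) is large for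
    some N ([dyadic_jump]).  The four-point inequality then shows that the
    orbit of g^N is quasi-additive, a(i) + a(j) <= a(i + j) + const along
    multiples of N ([orbit_quasi_additive]).  So each point of this orbit is at
    bounded distance from the geodesics from o to later points, and in the limit
    from c ([orbit_near_ray]).  The stability of general
    quasi-geodesics is not needed for the orbits of a cyclic group. *)

(** * Geodesics and asymptotic rays *)

Section Geodesics.
Context {R : realType} {X : metricType R}.
Implicit Types (p q x y z : X) (s c : R -> X) (D E t r : R).

Lemma geodesic_path_distl p q s t :
  geodesic_path p q s -> 0 <= t <= mdist p q -> mdist p (s t) = t.
Proof.
move=> [s0 sL sd] /andP[t0 tL]; rewrite -s0 sd ?t0 ?lexx ?mdist_ge0//.
by rewrite sub0r normrN ger0_norm.
Qed.

Lemma geodesic_path_distr p q s t :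
  geodesic_path p q s -> 0 <= t <= mdist p q ->
  mdist (s t) q = mdist p q - t.
Proof.
move=> [s0 sL sd] /andP[t0 tL]; rewrite -{1}sL sd ?t0 ?lexx ?mdist_ge0//.
by rewrite distrC ger0_norm// subr_ge0.
Qed.

Lemma geodesic_path_rev p q s :
  geodesic_path p q s -> geodesic_path q p (fun t => s (mdist p q - t)).
Proof.
move=> [s0 sL sd]; split; rewrite ?subr0// (metric_sym q p) ?subrr//.
move=> t u /andP[t0 tL] /andP[u0 uL]; rewrite sd; last 2 first.
- by apply/andP; split; lra.
- by apply/andP; split; lra.
by rewrite -normrN; congr (`|_|); ring.
Qed.

Lemma geodesic_path_segment p q s :
  geodesic_path p q s ->
  geodesic_segment p q (s @` [set t | 0 <= t <= mdist p q]).
Proof. by move=> sP; exists s. Qed.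

Lemma geodesic_ray_path c t :
  geodesic_ray c -> 0 <= t -> geodesic_path (c 0) (c t) c.
Proof.
move=> cP t0; have ct : mdist (c 0) (c t) = t.
  by rewrite cP// sub0r normrN ger0_norm.
split; rewrite ?ct// => u v /andP[u0 _] /andP[v0 _]; exact: cP.
Qed.

(** If s t is close to some point of s', then it is close to the point of s'
    with the same parameter, because the starting points are close. *)
Lemma geodesic_fellow p q p' q' s s' D E t t' :
  geodesic_path p q s -> geodesic_path p' q' s' -> mdist p p' <= D ->
  0 <= t <= mdist p q -> 0 <= t' <= mdist p' q' -> t <= mdist p' q' ->
  mdist (s t) (s' t') <= E -> mdist (s t) (s' t) <= 2 * E + D.
Proof.
move=> sP s'P pp' tI t'I tL' st.
have tI' : 0 <= t <= mdist p' q' by case/andP: tI => -> _.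
have e1 := geodesic_path_distl sP tI.
have e2 := geodesic_path_distl s'P t'I.
have e3 : mdist (s' t') (s' t) = `|t' - t| by case: s'P => _ _ ->.
have h1 := metric_triangle p p' (s t).
have h2 := metric_triangle p' (s' t') (s t).
have h3 := metric_triangle p' p (s' t').
have h4 := metric_triangle p (s t) (s' t').
have h5 := metric_triangle (s t) (s' t') (s' t).
have e4 := metric_sym p p'; have e5 := metric_sym (s t) (s' t').
have : `|t' - t| <= D + E by rewrite ler_norml; apply/andP; split; lra.
lra.
Qed.

Lemma asymptotic_refl c : asymptotic c c.
Proof. by exists 0 => t _; rewrite mdistxx. Qed.

Lemma asymptotic_sym c c' : asymptotic c c' -> asymptotic c' c.
Proof. by case=> M cM; exists M => t t0; rewrite metric_sym cM. Qed.

Lemma asymptotic_trans c1 c2 c3 :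
  asymptotic c1 c2 -> asymptotic c2 c3 -> asymptotic c1 c3.
Proof.
move=> [M cM] [N cN]; exists (M + N) => t t0.
by apply: le_trans (metric_triangle _ (c2 t) _) _; rewrite lerD ?cM ?cN.
Qed.

Lemma asymptotic_pos c c' (M : R) :
  (forall t, 0 < t -> mdist (c t) (c' t) <= M) -> asymptotic c c'.
Proof.
move=> cM; exists (Num.max M (mdist (c 0) (c' 0))) => t; rewrite le_eqVlt.
by move=> /predU1P[<-|/cM tM]; rewrite le_max ?lexx ?orbT// tM.
Qed.

(** The boundary point of the ray c. *)
Definition endpoint c := [set c' | geodesic_ray c' /\ asymptotic c c'].

Lemma endpoint_id c : geodesic_ray c -> endpoint c c.
Proof. by move=> cray; split=> //; exact: asymptotic_refl. Qed.

End Geodesics.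

(** * Limits of geodesics *)

Section Convergence.
Context {R : realType}.

(** Geodesics with close endpoints stay close at equal times, with a bound that
    depends only on the bound D on the distances of the endpoints. *)
Definition stable_quadrilaterals (X : metricType R) :=
  forall D : R, exists E : R, forall (p q p' q' : X) (s s' : R -> X),
    geodesic_path p q s -> geodesic_path p' q' s' ->
    mdist p p' <= D -> mdist q q' <= D ->
  forall t, 0 <= t <= mdist p q -> t <= mdist p' q' ->
    mdist (s t) (s' t) <= E.

(** Geodesics towards points that converge to the endpoint of a ray approach
    this ray, up to a constant that depends only on the space. *)
Definition rays_approximated (k : npc_kind) (X : metricType R) :=
  exists K : R, forall (u : nat -> X) (xi : set (R -> X)) (c : R -> X) (r : R),
    boundary_cvg k u xi -> xi c -> geodesic_ray c -> 0 < r ->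
    \forall n \near \oo, r < mdist (c 0) (u n) /\
      forall s, geodesic_path (c 0) (u n) s -> mdist (s r) (c r) <= K.

(** The path c' need not be a ray: it is a limit, up to the constant K', of
    geodesics to points at distance at most D from u n. *)
Lemma asymptotic_limit k (X : metricType R) (u : nat -> X)
    (xi : set (R -> X)) (c c' : R -> X) (D K' : R) :
  geodesic_space X -> stable_quadrilaterals X -> rays_approximated k X ->
  boundary_cvg k u xi -> xi c -> geodesic_ray c ->
  (forall r, 0 < r -> \forall n \near \oo,
     exists v s', [/\ geodesic_path (c' 0) v s', mdist (u n) v <= D,
       r <= mdist (c' 0) v & mdist (s' r) (c' r) <= K']) ->
  asymptotic c c'.
Proof.
move=> gX quad [K approx] uxi xic cray app'.
have [E quadE] := quad (Num.max D (mdist (c 0) (c' 0))).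
apply: (@asymptotic_pos _ _ _ _ (K + E + K')) => r r0.
have ev := filterI (approx _ _ _ _ uxi xic cray r0) (app' _ r0).
have [n [[rL sK] [v [s' [s'P uv rL' s'K]]]]] := filter_ex (ev _).
have [s sP] := gX (c 0) (u n).
have h1 := sK _ sP.
have h2 : mdist (s r) (s' r) <= E.
  apply: (quadE _ _ _ _ _ _ sP s'P) => //.
  - by rewrite le_max lexx orbT.
  - by rewrite le_max uv.
  - by rewrite !ltW.
have h3 := metric_triangle (c r) (s r) (c' r).
have h4 := metric_triangle (s r) (s' r) (c' r).
by have h5 := metric_sym (s r) (c r); lra.
Qed.

End Convergence.

(** * CAT(0) spaces *)

Section Cat0.
Context {R : realType}.

Lemma edistE (p q : R * R) (d : R) : 0 <= d ->
  (p.1 - q.1) ^+ 2 + (p.2 - q.2) ^+ 2 = d ^+ 2 -> Defs.edist p q = d.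
Proof.
by move=> d0; rewrite /Defs.edist => ->; rewrite sqrtr_sqr ger0_norm.
Qed.

(** The vertex q is (a, 0), and r is found by the law of cosines. *)
Lemma comparison_triangle (a b c : R) : 0 <= a -> 0 <= b -> 0 <= c ->
  a <= b + c -> b <= a + c -> c <= a + b ->
  exists q r : R * R,
    [/\ Defs.edist (0, 0) q = a, Defs.edist (0, 0) r = b & Defs.edist q r = c].
Proof.
move=> a0 b0 c0 abc bac cab; have [az|an] := eqVneq a 0.
  have cb : c = b by apply/eqP; rewrite eq_le; apply/andP; split; lra.
  by exists (0, 0), (b, 0); split; apply: edistE; rewrite ?az ?cb//=; ring.
have ap : 0 < a by rewrite lt_def an.
pose x := (a ^+ 2 + b ^+ 2 - c ^+ 2) / (2 * a).
have xe : 2 * a * x = a ^+ 2 + b ^+ 2 - c ^+ 2.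
  by rewrite /x mulrC divfK// mulf_neq0// pnatr_eq0.
have xb : x ^+ 2 <= b ^+ 2.
  rewrite -ler_sqrt; last by rewrite exprn_ge0.
  rewrite !sqrtr_sqr (ger0_norm b0) ler_norml; apply/andP; split.
  - rewrite -(ler_pM2l (_ : 0 < 2 * a)); last by rewrite mulr_gt0.
    by rewrite xe; nra.
  - rewrite -(ler_pM2l (_ : 0 < 2 * a)); last by rewrite mulr_gt0.
    by rewrite xe; nra.
have ye : Num.sqrt (b ^+ 2 - x ^+ 2) ^+ 2 = b ^+ 2 - x ^+ 2.
  by rewrite sqr_sqrtr// subr_ge0.
exists (a, 0), (x, Num.sqrt (b ^+ 2 - x ^+ 2)); split; apply: edistE => //=.
- ring.
- by rewrite !sub0r !sqrrN ye; ring.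
- rewrite sub0r sqrrN ye.
  have -> : (a - x) ^+ 2 = a ^+ 2 - 2 * a * x + x ^+ 2 by ring.
  by rewrite xe; ring.
Qed.

Variable X : metricType R.
Hypothesis catX : cat0_inequality X.

(** Two sides with a common vertex p, parametrized proportionally to arc length,
    diverge at most linearly. *)
Lemma cat0_vertex (p q r : X) (s1 s2 : R -> X) (a : R) :
  geodesic_path p q s1 -> geodesic_path p r s2 -> 0 <= a <= 1 ->
  mdist (s1 (a * mdist p q)) (s2 (a * mdist p r)) <= a * mdist q r.
Proof.
move=> s1P s2P /andP[a0 a1].
have pq := mdist_ge0 p q; have pr := mdist_ge0 p r; have qr := mdist_ge0 q r.
have [q' [r' [eq er eqr]]] : exists q' r' : R * R,
    [/\ Defs.edist (0, 0) q' = mdist p q, Defs.edist (0, 0) r' = mdist p r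
      & Defs.edist q' r' = mdist q r].
  apply: comparison_triangle => //.
  - by have := metric_triangle p r q; rewrite (metric_sym r q).
  - exact: metric_triangle.
  - by have := metric_triangle q p r; rewrite (metric_sym q p).
have scale (w : R * R) :
    Defs.edist (0, 0) (a * w.1, a * w.2) = a * Defs.edist (0, 0) w.
  apply: edistE; rewrite ?mulr_ge0 ?sqrtr_ge0//= exprMn sqr_sqrtr/=; last first.
    by rewrite addr_ge0// sqr_ge0.
  ring.
have scale2 :
    Defs.edist (a * q'.1, a * q'.2) (a * r'.1, a * r'.2) = a * mdist q r.
  rewrite -eqr; apply: edistE; rewrite ?mulr_ge0 ?sqrtr_ge0//=.
  rewrite exprMn sqr_sqrtr/=; last first.
    by rewrite addr_ge0// sqr_ge0.
  ring.
have aI (l : R) : 0 <= l -> 0 <= a * l <= l.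
  by move=> l0; rewrite mulr_ge0//= ler_piMl.
rewrite -scale2.
apply: (catX (geodesic_path_segment s1P) (geodesic_path_segment s2P) eq er eqr).
- by exists (a * mdist p q) => //=; exact: aI.
- by exists a; rewrite ?a0//= !mulr0 !add0r.
- by rewrite scale eq (geodesic_path_distl s1P)// aI.
- by exists (a * mdist p r) => //=; exact: aI.
- by exists a; rewrite ?a0//= !mulr0 !add0r.
- by rewrite scale er (geodesic_path_distl s2P)// aI.
Qed.

Lemma cat0_stable_quadrilaterals :
  geodesic_space X -> stable_quadrilaterals X.
Proof.
move=> gX D; exists (2 * D + D) => p q p' q' s s' sP s'P pp' qq' t tI tL'.
(* The diagonal m is compared with s at the vertex p, and with s', backwards,
   at the vertex q'. *)
have [m mP] := gX p q'.
pose a := if mdist p q == 0 then 0 else t / mdist p q.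
case/andP: (tI) => t0 tL.
have at_ : a * mdist p q = t.
  rewrite /a; case: eqVneq => [e|e]; last by rewrite divfK.
  by rewrite mul0r; apply/eqP; rewrite eq_le t0 -e tL.
have aI : 0 <= a <= 1.
  rewrite /a; case: eqVneq => [e|e]; first by rewrite lexx ler01.
  have Lp : 0 < mdist p q by rewrite lt_def e mdist_ge0.
  by rewrite divr_ge0 ?mdist_ge0//= ler_pdivrMr// mul1r.
have h1 := cat0_vertex sP mP aI.
have bI : 0 <= 1 - a <= 1 by case/andP: aI => ? ?; apply/andP; split; lra.
have h2 := cat0_vertex (geodesic_path_rev mP) (geodesic_path_rev s'P) bI.
move: h2 => /=; rewrite (metric_sym q' p) (metric_sym q' p').
have -> : mdist p q' - (1 - a) * mdist p q' = a * mdist p q' by ring.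
have -> : mdist p' q' - (1 - a) * mdist p' q' = a * mdist p' q' by ring.
move=> h2; rewrite at_ in h1.
apply: (geodesic_fellow sP s'P pp' tI _ tL' (t' := a * mdist p' q')).
  case/andP: aI => a0 a1.
  by rewrite mulr_ge0 ?mdist_ge0//= ler_piMl// mdist_ge0.
have h3 := metric_triangle (s t) (m (a * mdist p q')) (s' (a * mdist p' q')).
case/andP: aI => a0 a1.
have h4 : a * mdist q q' <= a * D by rewrite ler_wpM2l.
have h5 : (1 - a) * mdist p p' <= (1 - a) * D by rewrite ler_wpM2l// subr_ge0.
have : a * D + (1 - a) * D = D by ring.
lra.
Qed.

Lemma cat0_rays_approximated : rays_approximated CompleteCat0 X.
Proof.
exists 1 => u xi c r uxi xic cray r0.
by apply: filterS (uxi _ xic r 1 r0 ltr01) => n [rL sP]; split=> // s /sP/ltW.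
Qed.

End Cat0.

(** * Hyperbolic spaces *)

Section GromovProduct.
Context {R : realType} {X : metricType R}.
Implicit Types (o p y z : X) (c : R -> X).

Lemma gromov_product_le1 p y z : gromov_product p y z <= mdist p y.
Proof.
rewrite /gromov_product.
have := metric_triangle z y p; have := metric_sym y p; have := metric_sym z y.
lra.
Qed.

Lemma gromov_cvgP (u : nat -> X) (xi : set (R -> X)) c o (M : R) :
  gromov_cvg u xi -> xi c ->
  exists n0 T, forall n t, (n0 <= n)%N -> T <= t ->
    M <= gromov_product o (u n) (c t).
Proof.
move=> uxi xic; have [[A B] /= [[n0 _ An] [T [_ BT]]] AB] := uxi _ xic o M.
exists n0, (T + 1) => n t n0n Tt; apply: (AB (n, t)); split => /=.
  exact: An.
by apply: BT; lra.
Qed.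

End GromovProduct.

(** Among the three sums of distances of opposite pairs in a quadruple of
    points, the largest two differ by at most D. *)
Definition four_point {R : realType} (X : metricType R) (D : R) :=
  forall p x y z : X,
  mdist x z + mdist y p <= mdist x y + mdist z p + D \/
  mdist x z + mdist y p <= mdist y z + mdist x p + D.

Section Hyperbolic.
Context {R : realType} {X : metricType R}.
Variable delta : R.
Hypothesis delta0 : 0 <= delta.
Hypothesis gX : geodesic_space X.
Hypothesis thin : thin_triangles X delta.
Implicit Types (p q x y z w : X) (s c : R -> X) (D E t r : R).

Lemma thin_segments p q z s1 s2 s3 t :
  geodesic_path p q s1 -> geodesic_path p z s2 -> geodesic_path q z s3 ->
  0 <= t <= mdist p q ->
  (exists2 t', 0 <= t' <= mdist p z & mdist (s1 t) (s2 t') <= delta) \/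
  (exists2 t', 0 <= t' <= mdist q z & mdist (s1 t) (s3 t') <= delta).
Proof.
move=> s1P s2P s3P tI.
have [_ [[t' t'I <-]|[t' t'I <-]] yd] := thin (geodesic_path_segment s1P)
  (geodesic_path_segment s3P) (geodesic_path_segment (geodesic_path_rev s2P))
  (ex_intro2 _ _ t tI erefl).
- by right; exists t'.
- left; exists (mdist p z - t') => //.
  move: t'I => /= /andP[t0 tL]; rewrite (metric_sym z p) in tL.
  by apply/andP; split; lra.
Qed.

Lemma hyperbolic_stable_quadrilaterals : stable_quadrilaterals X.
Proof.
have d0 := delta0.
move=> D; exists (2 * (2 * delta + D) + D) => p q p' q' s s' sP s'P pp' qq' t.
move=> tI tL'.
suff [t' t'I st'] : exists2 t', 0 <= t' <= mdist p' q' &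
    mdist (s t) (s' t') <= 2 * delta + D.
  exact: (geodesic_fellow sP s'P pp' tI t'I tL').
have [m mP] := gX p q'; have [e eP] := gX p p'; have [f fP] := gX q q'.
have L'0 : 0 <= mdist p' q' by exact: mdist_ge0.
have D0 : 0 <= D by apply: le_trans pp'; exact: mdist_ge0.
have [[t1 t1I d1]|[t1 t1I d1]] := thin_segments sP mP fP tI; last first.
  exists (mdist p' q'); first by rewrite L'0 lexx.
  have -> : s' (mdist p' q') = q' by case: s'P.
  have h1 := geodesic_path_distr fP t1I.
  have h2 := metric_triangle (s t) (f t1) q'.
  by case/andP: t1I => ? ?; lra.
have t1I' : 0 <= mdist p q' - t1 <= mdist q' p.
  by rewrite (metric_sym q' p); case/andP: t1I => ? ?; apply/andP; split; lra.
have := thin_segments (geodesic_path_rev mP) (geodesic_path_rev s'P) eP t1I'.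
have -> : mdist p q' - (mdist p q' - t1) = t1 by ring.
case=> [[t2 t2I d2]|[t2 t2I d2]].
  exists (mdist p' q' - t2).
    rewrite (metric_sym q' p') in t2I; case/andP: t2I => ? ?.
    by apply/andP; split; lra.
  by have := metric_triangle (s t) (m t1) (s' (mdist p' q' - t2)); lra.
exists 0; first by rewrite L'0 lexx.
have -> : s' 0 = p' by case: s'P.
have h1 := geodesic_path_distr eP t2I.
have h2 := metric_triangle (s t) (m t1) p'.
have h3 := metric_triangle (m t1) (e t2) p'.
by case/andP: t2I => ? ?; lra.
Qed.

(** A point of the third side is at distance at least the Gromov product from p,
    so s t, which is too close to p, is near s' instead. *)
Lemma gromov_fellow p y z s s' t :
  geodesic_path p y s -> geodesic_path p z s' -> 0 <= t ->
  t + delta < gromov_product p y z -> mdist (s t) (s' t) <= 2 * delta.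
Proof.
have d0 := delta0.
rewrite /gromov_product => sP s'P t0 tg.
have [m mP] := gX y z.
have h1 := metric_triangle y p z; have h2 := metric_triangle z y p.
have h3 := metric_triangle y z p.
have e1 := metric_sym y p; have e2 := metric_sym z p; have e3 := metric_sym z y.
have tL : t <= mdist p y by lra.
have tL' : t <= mdist p z by lra.
have tI : 0 <= t <= mdist p y by rewrite t0.
have tI' : 0 <= t <= mdist p z by rewrite t0.
have d1 := geodesic_path_distl sP tI.
have [[u uI su]|[u uI su]] := thin_segments sP s'P mP tI.
  have d2 := geodesic_path_distl s'P uI.
  have h4 := metric_triangle p (s t) (s' u).
  have h5 := metric_triangle p (s' u) (s t).
  have h6 := metric_triangle (s t) (s' u) (s' t).
  have e4 := metric_sym (s t) (s' u).
  have e5 : mdist (s' u) (s' t) = `|u - t| by case: s'P => _ _ ->.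
  have : `|u - t| <= delta by rewrite ler_norml; apply/andP; split; lra.
  lra.
have d2 := geodesic_path_distl mP uI; have d3 := geodesic_path_distr mP uI.
have h4 := metric_triangle p (s t) (m u); have h5 := metric_triangle p (m u) y.
have h6 := metric_triangle p (m u) z; have e4 := metric_sym y (m u).
lra.
Qed.

Lemma hyperbolic_four_point : four_point X (6 * delta + 2).
Proof.
have d0 := delta0.
move=> p x y z.
pose t := Num.min (gromov_product p x y) (gromov_product p y z) - delta - 1.
suff : t <= gromov_product p x z + 2 * delta.
  rewrite /t; have [|] := leP (gromov_product p x y) (gromov_product p y z).
  - by rewrite /gromov_product => ? ?; left; lra.
  - by rewrite /gromov_product => ? ?; right; lra.
have [t0|t0] := ltP t 0.
  have : 0 <= gromov_product p x z.
    by rewrite /gromov_product; have := metric_triangle x p z;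
      have := metric_sym z p; lra.
  lra.
have [sx sxP] := gX p x; have [sy syP] := gX p y; have [sz szP] := gX p z.
have mx : t + delta < gromov_product p x y.
  have : t <= gromov_product p x y - delta - 1 by rewrite !lerD2r ge_min lexx.
  lra.
have mz : t + delta < gromov_product p y z.
  have : t <= gromov_product p y z - delta - 1.
    by rewrite !lerD2r ge_min lexx orbT.
  lra.
have h1 := gromov_fellow sxP syP t0 mx; have h2 := gromov_fellow syP szP t0 mz.
have h3 := metric_triangle (sx t) (sy t) (sz t).
have tx : 0 <= t <= mdist p x.
  by rewrite t0/=; have := gromov_product_le1 p x y; lra.
have tz : 0 <= t <= mdist p z.
  rewrite t0/=; have := gromov_product_le1 p z y.
  rewrite /gromov_product (metric_sym z y).
  by rewrite /gromov_product in mz; lra.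
have ex := geodesic_path_distr sxP tx; have ez := geodesic_path_distr szP tz.
have h4 := metric_triangle x (sx t) z.
have h5 := metric_triangle (sx t) (sz t) z.
rewrite /gromov_product (metric_sym x p) (metric_sym z p).
by have := metric_sym x (sx t); lra.
Qed.

Lemma hyperbolic_rays_approximated : rays_approximated ProperHyperbolic X.
Proof.
have d0 := delta0.
exists (2 * delta) => u xi c r uxi xic cray r0.
have [n0 [T uT]] := gromov_cvgP (c 0) (r + delta + 1) uxi xic.
exists n0 => // n /= n0n; set t := Num.max T r.
have := uT n t n0n; rewrite le_max lexx => /(_ isT) ut.
have t0 : 0 <= t by rewrite le_max (ltW r0) orbT.
split; first by have := gromov_product_le1 (c 0) (u n) (c t); lra.
move=> s sP; apply: (gromov_fellow sP (geodesic_ray_path cray t0) (ltW r0)).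
lra.
Qed.

End Hyperbolic.

(** * Orbits of linear growth *)

Section OrbitGrowth.
Context {R : realType}.

(** Otherwise a (2 ^ i) would grow at most linearly in i, and not like 2 ^ i. *)
Lemma dyadic_jump (a : nat -> R) (L C K : R) : 0 < L -> 0 <= K ->
  (forall n, L^-1 * n%:R - C <= a n) ->
  exists2 N, (0 < N)%N & a N + K <= a (2 * N)%N.
Proof.
move=> L0 K0 aL; apply: contrapT => noN.
have step i : a (2 ^ i)%N <= a 1%N + i%:R * K.
  elim: i => [|i IH]; first by rewrite expn0 mul0r addr0.
  rewrite expnS leNgt; apply/negP => lti; apply: noN.
  exists (2 ^ i)%N; rewrite ?expn_gt0//; apply: ltW; apply: le_lt_trans lti.
  by rewrite -[in i.+1%:R]addn1 natrD mulrDl mul1r addrA lerD2r.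
(* At the exponent 2 j, 2 ^ (2 j) >= j * 2 ^ j >= j ^ 2 beats the bound
   a 1 + 2 j K as soon as j / L > 2 K + |a 1 + C| + 1. *)
have [j jb] : exists j : nat, L * (2 * K + `|a 1%N + C| + 1) < j%:R.
  exists (Num.Def.archi_bound (L * (2 * K + `|a 1%N + C| + 1))).
  apply: archi_boundP; rewrite mulr_ge0 ?ltW//.
  by have := normr_ge0 (a 1%N + C); lra.
have Li0 : 0 < L^-1 by rewrite invr_gt0.
have {}jb : 2 * K + `|a 1%N + C| + 1 < L^-1 * j%:R.
  by rewrite -(ltr_pM2l L0) mulrA divff ?gt_eqF// mul1r.
have j1 : 1 <= j%:R :> R.
  rewrite (ler_nat R 1 j) lt0n; apply/eqP => j0; move: jb; rewrite j0 mulr0.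
  by have := normr_ge0 (a 1%N + C); lra.
have := aL (2 ^ (2 * j))%N; have := step (2 * j)%N.
have pj : j%:R <= (2 ^ j)%:R :> R by rewrite ler_nat ltnW// ltn_expl.
have : L^-1 * (j%:R * j%:R) <= L^-1 * (2 ^ (2 * j))%:R.
  by rewrite ler_pM2l// mulnC expnM expnS expn1 natrM ler_pM.
rewrite mulrA natrM => h1 h2 h3.
have h4 : (2 * K + `|a 1%N + C| + 1) * j%:R <= L^-1 * j%:R * j%:R.
  by rewrite ler_pM2r ?(lt_le_trans ltr01)// ltW.
have h5 : `|a 1%N + C| <= `|a 1%N + C| * j%:R by rewrite ler_peMr.
have h6 := ler_norm (a 1%N + C).
nra.
Qed.

(* The sequence y has the distances of an orbit of an isometry, and its second
   step gains at least 2 D over the first. *)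
Variable X : metricType R.
Variables (D : R) (y : nat -> X).
Hypothesis D0 : 0 < D.
Hypothesis four : four_point X D.
Hypothesis stat : forall i j, mdist (y i) (y (i + j)%N) = mdist (y 0%N) (y j).
Hypothesis jump : mdist (y 0%N) (y 1%N) + 2 * D <= mdist (y 0%N) (y 2%N).

Let a n := mdist (y 0%N) (y n).

(** The initial jump propagates: compare the distances between the points
    0, 1, 2 and j + 2 of the orbit. *)
Lemma orbit_increment j : a j + D <= a j.+1.
Proof.
have d0 := D0; have a21 : a 1%N + 2 * D <= a 2%N by exact: jump.
elim: j => [|j IH].
  have : a 2%N <= a 1%N + a 1%N.
    rewrite /a -[X in _ + X](stat 1 1); exact: metric_triangle.
  have -> : a 0%N = 0 by exact: mdistxx.
  lra.
have := four (y j.+2) (y 0%N) (y 1%N) (y 2%N).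
rewrite -[j.+2]/(1 + j.+1)%N (stat 1 j.+1) -[(1 + j.+1)%N]/(2 + j)%N (stat 2 j).
rewrite (stat 1 1) -[(2 + j)%N]/j.+2 -!/(a _).
by case; lra.
Qed.

(** By induction on j, with the four-point inequality for the points 0, j, j + 1
    and j + 1 + i of the orbit.  The constant does not accumulate, because
    [orbit_increment] gains D at each step. *)
Lemma orbit_quasi_additive j i : a j + a i <= a (j + i)%N + 2 * a 1%N + D.
Proof.
have d0 := D0; have a1 : 0 <= a 1%N by exact: mdist_ge0.
elim: j i => [|j IH] i.
  by have -> : a 0%N = 0 by [exact: mdistxx]; rewrite add0n; lra.
have := four (y (j.+1 + i)%N) (y 0%N) (y j) (y j.+1).
have -> : mdist (y j) (y j.+1) = a 1%N by rewrite -addn1; exact: stat.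
have -> : mdist (y j) (y (j.+1 + i)%N) = a i.+1 by rewrite addSnnS stat.
rewrite stat -!/(a _) => h.
have h1 := IH i.+1; rewrite -addSnnS in h1.
have h2 := orbit_increment i.
by case: h; lra.
Qed.

(** By [orbit_quasi_additive], y j is near the geodesics from y 0 to y k for
    k >= j; when k and t are large, the Gromov product of y k and c t exceeds
    the distance from y 0 to y j, so y j is near the segment of c up to c t. *)
Lemma orbit_near_ray (c : R -> X) : geodesic_ray c ->
  c 0 = y 0%N ->
  (forall M, exists n0 T, forall n t, (n0 <= n)%N -> T <= t ->
     M <= gromov_product (c 0) (y n) (c t)) ->
  exists V, forall j, exists2 t, 0 <= t & mdist (y j) (c t) <= V.
Proof.
move=> cray c0 cvg; exists (a 1%N + 3 * D) => j.
have [n0 [T nT]] := cvg (2 * a j + a 1%N + 2 * D).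
pose t := Num.max T 0; pose k := (j + n0)%N.
have t0 : 0 <= t by rewrite le_max lexx orbT.
have := nT k t (leq_addl _ _); rewrite le_max lexx => /(_ isT).
rewrite /gromov_product c0 (metric_sym (y k)) -/(a k) => g1.
have d0 := D0.
have a1 : 0 <= a 1%N by exact: mdist_ge0.
have aj : 0 <= a j by exact: mdist_ge0.
have yjk : mdist (y j) (y k) = a n0 by exact: stat.
have add := orbit_quasi_additive j n0; rewrite -/k in add.
have s1 := metric_sym (y j) (y 0%N); have s2 := metric_sym (c t) (y 0%N).
have s3 := metric_sym (y k) (c t); have s4 := metric_sym (c t) (y j).
have s5 := metric_sym (y k) (y j).
have tr1 := metric_triangle (y 0%N) (y j) (c t).
have tr2 := metric_triangle (y 0%N) (y j) (y k).
have g2 : mdist (y 0%N) (y j) + mdist (y j) (c t) <=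
    mdist (y 0%N) (c t) + 2 * a 1%N + 2 * D + D.
  have := four (y k) (y j) (y 0%N) (c t).
  rewrite /a in aj a1 add g1 yjk *.
  by case; lra.
(* r is the Gromov product of y j and c t at y 0, so c r is nearly a projection
   of y j to the segment of c up to c t. *)
have [r rE] : exists r, r =
    (mdist (y 0%N) (c t) + mdist (y 0%N) (y j) - mdist (y j) (c t)) / 2.
  by eexists.
have tE : mdist (y 0%N) (c t) = t by rewrite -c0 cray// sub0r normrN ger0_norm.
have r0 : 0 <= r.
  by rewrite rE; have := metric_triangle (y j) (y 0%N) (c t); lra.
exists r => //.
have rt : r <= t.
  by rewrite rE; have := metric_triangle (y 0%N) (c t) (y j); lra.
have e1 : mdist (y 0%N) (c r) = r by rewrite -c0 cray// sub0r normrN ger0_norm.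
have e2 : mdist (c r) (c t) = t - r.
  by rewrite cray// distrC ger0_norm// subr_ge0.
have s6 := metric_sym (c t) (c r); have s7 := metric_sym (c r) (y j).
have s8 := metric_sym (c r) (y 0%N).
have := four (c t) (y j) (y 0%N) (c r).
rewrite /a in d0 a1 aj g2 *; case=> ?; lra.
Qed.

End OrbitGrowth.

(** * Isometric actions on the boundary *)

Section IsometricAction.
Context {R : realType} {X : metricType R} {G : topologicalGroupType}.
Variable act : G -> X -> X.
Hypothesis hact : continuous_isometric_action act.
Implicit Types (g h : G) (c s : R -> X) (o p q x : X).

Lemma act_geodesic_path h p q s :
  geodesic_path p q s -> geodesic_path (act h p) (act h q) (act h \o s).
Proof.
move=> [s0 sL sd]; split; rewrite /= ?(act_isometry hact) ?s0 ?sL//.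
by move=> t u tI uI; rewrite (act_isometry hact) sd.
Qed.

Lemma act_geodesic_ray h c : geodesic_ray c -> geodesic_ray (act h \o c).
Proof. by move=> cray t u t0 u0 /=; rewrite (act_isometry hact) cray. Qed.

Lemma act_asymptotic h c c' :
  asymptotic c c' -> asymptotic (act h \o c) (act h \o c').
Proof. by case=> M cM; exists M => t t0 /=; rewrite (act_isometry hact) cM. Qed.

Lemma actKV h : cancel (act (h^-1)%g) (act h).
Proof. by move=> x; rewrite -(actM hact) mulgV (act1 hact). Qed.

Lemma boundary_stabilizerP c h : geodesic_ray c ->
  boundary_stabilizer act (endpoint c) h <-> asymptotic c (act h \o c).
Proof.
move=> cray; split=> [hc|hc].
  have : boundary_act act h (endpoint c) (act h \o c).
    by exists c => //; exact: endpoint_id.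
  by rewrite hc => -[].
apply/seteqP; split=> [_ [c' [c'ray cc'] <-]|c' [c'ray cc']].
  split; first exact: act_geodesic_ray.
  by apply: asymptotic_trans hc _; exact: act_asymptotic.
exists (act (h^-1)%g \o c'); last by apply/funext => t /=; rewrite actKV.
split; first exact: act_geodesic_ray.
apply: (asymptotic_trans (c2 := act (h^-1)%g \o c)); last exact: act_asymptotic.
case: hc => M hM; exists M => t t0 /=.
by rewrite -(act_isometry hact h) actKV metric_sym hM.
Qed.

Lemma mdist_continuous x : continuous (fun y : X => mdist x y : R).
Proof.
move=> y; apply/cvgrPdist_lt => e e0.
have := @nbhsx_ballx _ _ y e e0; apply: filterS => z.
rewrite ballEmdist /= => yz.
have h1 := metric_triangle x y z; have h2 := metric_triangle x z y.
have h3 := metric_sym y z.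
by rewrite ltr_norml; apply/andP; split; lra.
Qed.

Lemma compact_closure_displacement (A : set G) o :
  compact (closure A) ->
  exists M : R, forall h, A h -> mdist o (act h o) <= M.
Proof.
move=> cA; pose f h : R := mdist o (act h o).
have cf : continuous f.
  move=> h.
  apply: (@continuous_comp _ _ _ (fun k => act k o) (mdist o)); last first.
    exact: mdist_continuous.
  apply: (@continuous_comp G (G * X)%type X (fun k => pair k o)
    (fun p : G * X => act p.1 p.2)).
    by apply: cvg_pair; [exact: cvg_id|exact: cvg_cst].
  exact: (act_continuous hact).
have [M [_ MP]] := compact_bounded (continuous_compact
  (continuous_subspaceT cf) cA).
exists (M + 1) => h Ah.
have M1 : M < M + 1 by rewrite ltrDl.
apply: le_trans (MP _ M1 _ (imageP f (subset_closure Ah))).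
exact: ler_norm.
Qed.

Lemma conj_displacement g h n o :
  mdist o (act (g^-1 ^+ n * h * g^-1 ^- n)%g o) =
  mdist (act (g ^+ n)%g o) (act h (act (g ^+ n)%g o)).
Proof.
rewrite -(act_isometry hact (g ^+ n)%g) -!(actM hact) expVgn invgK !mulgA.
by rewrite mulgV mul1g.
Qed.

Lemma parabolic_group_displacement g h o : parabolic_group (g^-1)%g h ->
  exists M : R, forall n,
    mdist (act (g ^+ n)%g o) (act h (act (g ^+ n)%g o)) <= M.
Proof.
move=> /(@compact_closure_displacement _ o)[M hM]; exists M => n.
by rewrite -conj_displacement; apply: hM; exists n.
Qed.

Lemma displacement_parabolic_group g h o (M : R) : proper_action act ->
  (forall n, mdist (act (g ^+ n)%g o) (act h (act (g ^+ n)%g o)) <= M) ->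
  parabolic_group (g^-1)%g h.
Proof.
move=> prop hM; have M0 : 0 < Num.max M 1 by rewrite lt_max ltr01 orbT.
apply: (subclosed_compact _ (prop o _ M0)); first exact: closed_closure.
apply: closure_subset => _ [n _ <-] /=.
by rewrite metric_sym conj_displacement le_max hM.
Qed.

Lemma orbit_stationary g x i j :
  mdist (act (g ^+ i)%g x) (act (g ^+ (i + j))%g x) =
  mdist (act (g ^+ 0)%g x) (act (g ^+ j)%g x).
Proof.
by rewrite expg0 (act1 hact) expgnDr (actM hact) (act_isometry hact).
Qed.

Lemma orbit_dist_le g x i :
  mdist x (act (g ^+ i)%g x) <= i%:R * mdist x (act g x).
Proof.
elim: i => [|i IH]; first by rewrite expg0 (act1 hact) mdistxx mul0r.
apply: le_trans (metric_triangle _ (act (g ^+ i)%g x) _) _.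
have := orbit_stationary g x i 1.
rewrite addn1 expg0 expg1 (act1 hact) => ->.
by rewrite -[in i.+1%:R]addn1 natrD mulrDl mul1r lerD2r.
Qed.

End IsometricAction.

(** * Displacement along the orbit of g *)

Section NPC.
Context {R : realType} {X : metricType R} {G : topologicalGroupType}.
Variables (k : npc_kind) (act : G -> X -> X).
Hypothesis hX : npc k X.
Hypothesis hact : continuous_isometric_action act.

Lemma npc_geodesics :
  [/\ geodesic_space X, stable_quadrilaterals X & rays_approximated k X].
Proof.
case: k hX => /=.
- move=> [_ [gX cX]]; split=> //; first exact: cat0_stable_quadrilaterals.
  exact: cat0_rays_approximated.
- move=> [_ [gX [delta d0 thin]]]; split=> //.
    exact: hyperbolic_stable_quadrilaterals d0 gX thin.
  exact: hyperbolic_rays_approximated d0 gX thin.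
Qed.

Lemma displacement_asymptotic (u : nat -> X) (c : R -> X) (h : G) (M : R) :
  geodesic_ray c -> boundary_cvg k u (endpoint c) ->
  (forall n, mdist (u n) (act h (u n)) <= M) -> asymptotic c (act h \o c).
Proof.
move=> cray uc uM; have [gX quad approx] := npc_geodesics.
have [K approxK] := approx.
apply: (asymptotic_limit (D := M) (K' := K) gX quad approx uc) => //.
  exact: endpoint_id.
move=> r r0; have := approxK _ _ _ _ uc (endpoint_id cray) cray r0.
apply: filterS => n [rL sK]; have [s sP] := gX (c 0) (u n).
exists (act h (u n)), (act h \o s); split=> //.
- exact: act_geodesic_path.
- by rewrite /= (act_isometry hact) ltW.
- by rewrite /= (act_isometry hact) sK.
Qed.

(** The positive half of the axis is a ray to the attracting point, and h moves
    the points of such a ray a bounded distance. *)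
Lemma axis_displacement (g h : G) (c : R -> X) :
  geodesic_ray c ->
  (forall x, boundary_cvg k (fun n => act (g ^+ n)%g x) (endpoint c)) ->
  has_axis act g -> asymptotic c (act h \o c) ->
  exists o (M : R), forall n,
    mdist (act (g ^+ n)%g o) (act h (act (g ^+ n)%g o)) <= M.
Proof.
move=> cray attr [gam [l [line l0 ax]]] ch.
have [gX quad approx] := npc_geodesics.
have gn n : act (g ^+ n)%g (gam 0) = gam (n%:R * l).
  elim: n => [|n IH]; first by rewrite expg0 (act1 hact) mul0r.
  by rewrite expgS (actM hact) IH ax -[in n.+1%:R]addn1 natrD mulrDl mul1r.
have ray : geodesic_ray gam by move=> t u _ _; exact: line.
have cgam : asymptotic c gam.
  apply: (asymptotic_limit (D := 0) (K' := 0) gX quad approx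
    (attr (gam 0))) => //; first exact: endpoint_id.
  move=> r r0; exists (Num.Def.archi_bound (r / l)) => // n /= rn.
  have rln : r <= n%:R * l.
    rewrite -ler_pdivrMr//; apply: ltW; apply: lt_le_trans (archi_boundP _) _.
      by rewrite divr_ge0// ltW.
    by rewrite ler_nat.
  have nl0 : 0 <= n%:R * l by rewrite mulr_ge0// ltW.
  exists (gam (n%:R * l)), gam; rewrite gn !mdistxx; split=> //.
    exact: geodesic_ray_path.
  by rewrite line sub0r normrN ger0_norm.
have [M hM] : asymptotic gam (act h \o gam).
  apply: asymptotic_trans (asymptotic_sym cgam) _.
  apply: asymptotic_trans ch _; exact: act_asymptotic.
exists (gam 0), M => n; rewrite gn; apply: hM.
by rewrite mulr_ge0// ltW.
Qed.

End NPC.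

(** The orbit of a suitable power f = g ^+ N satisfies the hypothesis of
    [orbit_near_ray], and the points g ^+ n are within a bounded distance of
    this orbit. *)
Lemma quasi_geodesic_displacement (R : realType) (X : metricType R)
    (G : topologicalGroupType) (act : G -> X -> X) (g h : G) (c : R -> X) :
  gromov_hyperbolic X -> continuous_isometric_action act -> geodesic_ray c ->
  gromov_cvg (fun n => act (g ^+ n)%g (c 0)) (endpoint c) ->
  (exists x, qi_embedded_orbit act g x) -> asymptotic c (act h \o c) ->
  exists o (M : R), forall n,
    mdist (act (g ^+ n)%g o) (act h (act (g ^+ n)%g o)) <= M.
Proof.
move=> [gX [delta d0 thin]] hact cray cvg [x [L [C [L1 C0 qi]]]] [M hM].
pose D := 6 * delta + 2; have D0 : 0 < D by rewrite /D; lra.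
have four : four_point X D := hyperbolic_four_point d0 gX thin.
pose a n := mdist (c 0) (act (g ^+ n)%g (c 0)).
have [N N0 jump] : exists2 N, (0 < N)%N & a N + 2 * D <= a (2 * N)%N.
  apply: (@dyadic_jump _ a L (C + 2 * mdist x (c 0))).
  - exact: lt_le_trans ltr01 L1.
  - by rewrite mulr_ge0// ltW.
  move=> n; have /andP[+ _] := qi (Posz 0) (Posz n).
  rewrite /= expg0 (act1 hact) sub0r normrN => /le_trans h1.
  have h2 := metric_triangle x (c 0) (act (g ^+ n)%g x).
  have h3 := metric_triangle (c 0) (act (g ^+ n)%g (c 0)) (act (g ^+ n)%g x).
  have h4 : mdist (act (g ^+ n)%g (c 0)) (act (g ^+ n)%g x) = mdist (c 0) x.
    exact: (act_isometry hact).
  have h5 := metric_sym x (c 0).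
  have h6 := h1 _ h2; rewrite -/(a n) in h3; rewrite -pmulrn in h6.
  lra.
pose f := (g ^+ N)%g.
have fE j : (f ^+ j = g ^+ (N * j))%g by rewrite expgnA.
have [V fV] : exists V, forall j, exists2 t, 0 <= t &
    mdist (act (f ^+ j)%g (c 0)) (c t) <= V.
  apply: (@orbit_near_ray _ _ D (fun j => act (f ^+ j)%g (c 0))) => //.
  - exact: orbit_stationary.
  - by rewrite !fE muln0 muln1 mulnC expg0 (act1 hact); exact: jump.
  - by rewrite expg0 (act1 hact).
  move=> B; have [n0 [T nT]] := gromov_cvgP (c 0) B cvg (endpoint_id cray).
  exists n0, T => n t n0n Tt; rewrite fE; apply: nT => //.
  by apply: leq_trans n0n _; rewrite leq_pmull.
pose W := N%:R * a 1%N.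
exists (c 0), (2 * (W + V) + M) => n.
pose j := (n %/ N)%N; pose i := (n %% N)%N.
have [t t0 jV] := fV j.
have nE : (g ^+ n = f ^+ j * g ^+ i)%g.
  by rewrite fE -expgnDr mulnC -divn_eq.
have nj : mdist (act (f ^+ j)%g (c 0)) (act (g ^+ n)%g (c 0)) <= W.
  rewrite nE (actM hact) (act_isometry hact).
  apply: le_trans (orbit_dist_le hact g (c 0) i) _.
  by rewrite /W /a expg1 ler_wpM2r ?mdist_ge0// ler_nat ltnW// ltn_pmod.
set z := act (g ^+ n)%g (c 0) in nj *.
have := metric_triangle z (act (f ^+ j)%g (c 0)) (c t).
have := metric_sym z (act (f ^+ j)%g (c 0)).
have := hM t t0; rewrite /=.
have := metric_triangle z (c t) (act h z).
have := metric_triangle (c t) (act h (c t)) (act h z).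
rewrite (act_isometry hact) (metric_sym (c t) z).
lra.
Qed.

Theorem theorem1p1 (R : realType) (k : npc_kind) (X : metricType R)
    (G : topologicalGroupType) (act : G -> X -> X) (xi : set (R -> X)) (g : G)
    (hX : npc k X)
    (hG : locally_compact [set: G])
    (hact : continuous_isometric_action act)
    (hxi : boundary xi)
    (hunb : ~ bounded_isometry act g)
    (hattr : attracting_point act k g xi) :
  parabolic_group (g^-1)%g `<=` boundary_stabilizer act xi /\
  (hyperbolic_isometry act k g -> proper_action act ->
   parabolic_group (g^-1)%g = boundary_stabilizer act xi).
Proof.
case: hxi hattr => c cray -> attr.
have sub : parabolic_group (g^-1)%g `<=` boundary_stabilizer act (endpoint c).
  move=> h /(parabolic_group_displacement hact (c 0))[M hM].
  apply/(boundary_stabilizerP hact) => //.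
  exact: (displacement_asymptotic hX hact cray (attr (c 0)) hM).
split=> // hyp prop; apply/seteqP; split=> // h.
move=> /(boundary_stabilizerP hact _ cray) ch.
suff [b [M hM]] : exists o (M : R), forall n,
    mdist (act (g ^+ n)%g o) (act h (act (g ^+ n)%g o)) <= M.
  exact: (displacement_parabolic_group hact prop hM).
case: k hX attr hyp => hX attr hyp.
- exact: (axis_displacement (k := CompleteCat0) hX hact cray attr hyp ch).
- case: hX => _ hypX.
  exact: (quasi_geodesic_displacement hypX hact cray (attr (c 0)) hyp ch).
Qed.
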